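(* Let $m<M$ be real numbers and let $f:[m,M]\to\mathbb{R}$ be a convex function. Let $n\ge 1$ be an integer, let $a_1,\ldots,a_n\in[m,M]$, let $w_1,\ldots,w_n\in[0,1]$ with $\sum_{i=1}^n w_i=1$, and put $\overline{a}:=\sum_{i=1}^n w_i a_i$. Then $$f\left(M+m-\overline{a}\right)\le \sum_{i=1}^{n}\frac{w_i}{\overline{a}-a_i}\int_{M+m-\overline{a}}^{M+m-a_i} f(t)\,dt\le f(M)+f(m)-\sum_{i=1}^{n} w_i f(a_i).$$
   Context: Integrals are oriented: $\int_x^y=-\int_y^x$ when $y<x$. For an index $i$ with $a_i=\overline{a}$, the quantity $\frac{1}{\overline{a}-a_i}\int_{M+m-\overline{a}}^{M+m-a_i} f(t)\,dt$ is understood as $f(M+m-\overline{a})$, i.e. as the value of $\int_0^1 f\left(M+m-\left((1-t)\overline{a}+t a_i\right)\right)dt$, with which it coincides when $a_i\ne\overline{a}$. *)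

(* Defs.v *)
From Stdlib Require Import Reals.
From Coquelicot Require Import Coquelicot.
Open Scope R_scope.

(* A function on [m, M] is represented by a total function R -> R; only its
   values on [m, M] matter. *)
Definition convex_on (m M : R) (f : R -> R) : Prop :=
  forall x y t : R,
    m <= x <= M -> m <= y <= M -> 0 <= t <= 1 ->
    f ((1 - t) * x + t * y) <= (1 - t) * f x + t * f y.

(* RInt is oriented: RInt f x y = - RInt f y x. The first branch is the
   conventional value of the quotient when a = abar. A convex function on
   [m, M] may jump at the endpoints but is Riemann integrable, so RInt is its
   actual integral whenever a and abar lie in [m, M]. *)
Definition reflected_mean (m M : R) (f : R -> R) (abar a : R) : R :=
  if Req_EM_T a abar then f (M + m - abar)
  else / (abar - a) * RInt f (M + m - abar) (M + m - a).

(* Main.v *)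
Require Import Defs.
From Stdlib Require Import Reals Lra Lia.
From Coquelicot Require Import Coquelicot.
Open Scope R_scope.

(** The point reflected in the midpoint of [[m, M]] to [x] is [M + m - x].
    Write [p] for the reflection of the weighted mean and [q i] for that of
    [a i].  As reflection is affine, [p] is the mean of the [q i] with the same
    weights, and [reflected_mean] is the average of [f] along the segment from
    [p] to [q i].  Two classical facts about convex functions then suffice.

    - Hermite-Hadamard ([average_between]): this average lies between the value
      of [f] at the midpoint of [p] and [q i] and the mean of [f p] and
      [f (q i)].
    - Jensen ([jensen]).  The midpoints of [p] and the [q i] again have weighted
      mean [p], so the weighted sum of the lower bounds is at least [f p].  The
      weighted sum of the upper bounds is half of [f p] plus half of the sum of
      [w i * f (q i)]; Jensen for the points [q i] bounds it by the latter sum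
      alone.  Finally [f (q i) <= f M + f m - f (a i)], because reflecting a
      point cannot make [f x + f (M + m - x)] larger than [f m + f M]
      ([convex_on_reflection]).

    The analytic part is that [f] is integrable ([convex_on_ex_RInt]): it is
    locally Lipschitz inside [[m, M]] and has finite one-sided limits at the
    endpoints, so on the open interval it agrees with a continuous function. *)

(** * Elementary consequences of convexity *)

(** Convexity without division, the form in which it is used to compare
    slopes of adjacent chords. *)
Lemma convex_on_chord m M f x y z :
  convex_on m M f -> m <= x -> x < y -> y < z -> z <= M ->
  (z - x) * f y <= (z - y) * f x + (y - x) * f z.
Proof.
intros Hf Hx Hxy Hyz Hz.
assert (Ht : 0 <= (y - x) / (z - x) <= 1).
{ split.
  - apply Rdiv_le_0_compat; lra.
  - apply Rmult_le_reg_r with (z - x); [lra|].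
    unfold Rdiv; rewrite Rmult_assoc, Rinv_l; lra. }
assert (H := Hf x z ((y - x) / (z - x)) ltac:(lra) ltac:(lra) Ht).
replace ((1 - (y - x) / (z - x)) * x + (y - x) / (z - x) * z) with y in H
  by (field; lra).
apply Rmult_le_compat_l with (r := z - x) in H; [|lra].
replace ((z - x) * ((1 - (y - x) / (z - x)) * f x + (y - x) / (z - x) * f z))
  with ((z - y) * f x + (y - x) * f z) in H by (field; lra).
exact H.
Qed.

Lemma convex_on_affine_comp m M f p q a b :
  convex_on m M f ->
  (forall t, a <= t <= b -> m <= p * t + q <= M) ->
  convex_on a b (fun t => f (p * t + q)).
Proof.
intros Hf H x y t Hx Hy Ht.
replace (p * ((1 - t) * x + t * y) + q)
  with ((1 - t) * (p * x + q) + t * (p * y + q)) by ring.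
apply Hf; auto.
Qed.

(** A point and its reflection are convex combinations of the endpoints with
    exchanged coefficients. *)
Lemma convex_on_reflection m M f x :
  m < M -> convex_on m M f -> m <= x <= M ->
  f x + f (M + m - x) <= f m + f M.
Proof.
intros HmM Hf Hx.
assert (Ht : 0 <= (x - m) / (M - m) <= 1).
{ split.
  - apply Rdiv_le_0_compat; lra.
  - apply Rmult_le_reg_r with (M - m); [lra|].
    unfold Rdiv; rewrite Rmult_assoc, Rinv_l; lra. }
assert (H1 := Hf m M ((x - m) / (M - m)) ltac:(lra) ltac:(lra) Ht).
assert (H2 := Hf M m ((x - m) / (M - m)) ltac:(lra) ltac:(lra) Ht).
replace ((1 - (x - m) / (M - m)) * m + (x - m) / (M - m) * M) with x in H1
  by (field; lra).
replace ((1 - (x - m) / (M - m)) * M + (x - m) / (M - m) * m)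
  with (M + m - x) in H2 by (field; lra).
lra.
Qed.

(** * Integrability of convex functions *)

(** The slopes of the chords issuing from an interior point [x] lie between
    those of the chords from [m] to [x] and from [x] to [M]. *)
Lemma convex_on_lipschitz_at m M f x :
  convex_on m M f -> m < x < M ->
  exists K, 0 < K /\
    forall y, m < y < M -> Rabs (f y - f x) <= K * Rabs (y - x).
Proof.
intros Hf Hx.
pose (s := (f x - f m) / (x - m)); pose (S := (f M - f x) / (M - x)).
assert (Es : f x - f m = s * (x - m)) by (unfold s; field; lra).
assert (ES : f M - f x = S * (M - x)) by (unfold S; field; lra).
(* The summand 1 only makes the constant positive. *)
exists (Rabs s + Rabs S + 1).
assert (Ps := Rabs_pos s). assert (PS := Rabs_pos S).
split; [lra|].
assert (Is : - Rabs s <= s <= Rabs s) by (apply Rabs_le_between; lra).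
assert (IS : - Rabs S <= S <= Rabs S) by (apply Rabs_le_between; lra).
intros y Hy.
destruct (Rtotal_order y x) as [Hyx|[->|Hyx]].
- assert (H1 := convex_on_chord m M f m y x Hf ltac:(lra) ltac:(lra) ltac:(lra) ltac:(lra)).
  assert (H2 := convex_on_chord m M f y x M Hf ltac:(lra) ltac:(lra) ltac:(lra) ltac:(lra)).
  assert (L1 : f y <= f x - s * (x - y)).
  { apply Rmult_le_reg_l with (x - m); [lra|].
    replace (f m) with (f x - s * (x - m)) in H1 by lra. lra. }
  assert (L2 : f x - f y <= S * (x - y)).
  { apply Rmult_le_reg_l with (M - x); [lra|].
    replace (f M) with (f x + S * (M - x)) in H2 by lra. lra. }
  rewrite (Rabs_left (y - x)) by lra.
  apply Rabs_le_between. split; nra.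
- rewrite !Rminus_diag, Rabs_R0; lra.
- assert (H1 := convex_on_chord m M f m x y Hf ltac:(lra) ltac:(lra) ltac:(lra) ltac:(lra)).
  assert (H2 := convex_on_chord m M f x y M Hf ltac:(lra) ltac:(lra) ltac:(lra) ltac:(lra)).
  assert (L1 : s * (y - x) <= f y - f x).
  { apply Rmult_le_reg_l with (x - m); [lra|].
    replace (f m) with (f x - s * (x - m)) in H1 by lra. lra. }
  assert (L2 : f y - f x <= S * (y - x)).
  { apply Rmult_le_reg_l with (M - x); [lra|].
    replace (f M) with (f x + S * (M - x)) in H2 by lra. lra. }
  rewrite (Rabs_right (y - x)) by lra.
  apply Rabs_le_between. split; nra.
Qed.

Lemma convex_on_continuous m M f x :
  convex_on m M f -> m < x < M -> filterlim f (locally x) (locally (f x)).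
Proof.
intros Hf Hx.
destruct (convex_on_lipschitz_at m M f x Hf Hx) as [K [HK HL]].
apply filterlim_locally. intros eps.
assert (Hd : 0 < Rmin (Rmin (x - m) (M - x)) (eps / K)).
{ repeat apply Rmin_glb_lt; try lra.
  apply Rdiv_lt_0_compat; [apply cond_pos | lra]. }
exists (mkposreal _ Hd). intros y Hy.
change (Rabs (y - x) < Rmin (Rmin (x - m) (M - x)) (eps / K)) in Hy.
change (Rabs (f y - f x) < eps).
apply Rmin_Rgt_l in Hy. destruct Hy as [Hy He].
apply Rmin_Rgt_l in Hy. destruct Hy as [Hy1 Hy2].
assert (Hb : - Rabs (y - x) <= y - x <= Rabs (y - x))
  by (apply Rabs_le_between; lra).
apply Rle_lt_trans with (1 := HL y ltac:(lra)).
replace (pos eps) with (K * (eps / K)) by (field; lra).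
apply Rmult_lt_compat_l; lra.
Qed.

(** Left of the midpoint [c] all chords have slope at most the slope [S] of the
    chord from [c] to [M].  Hence [f x - S * x] is nonincreasing there; being
    bounded above, it converges to its supremum. *)
Lemma convex_on_right_limit m M f :
  m < M -> convex_on m M f ->
  exists L, forall eps, 0 < eps -> exists d, 0 < d /\
    forall x, m < x < m + d -> Rabs (f x - L) < eps.
Proof.
intros HmM Hf.
(* Chords ending at [M] itself would not do: their slopes are unbounded when
   [f] jumps there. *)
pose (c := (m + M) / 2).
pose (S := (f M - f c) / (M - c)).
assert (Hc : m < c < M) by (unfold c; lra).
assert (ES : f M - f c = S * (M - c)) by (unfold S; field; lra).
assert (Hmon : forall x y, m < x -> x < y -> y < c ->
          f y - S * y <= f x - S * x).
{ intros x y Hx Hxy Hyc.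
  assert (H1 := convex_on_chord m M f x y c Hf ltac:(lra) ltac:(lra) ltac:(lra) ltac:(lra)).
  assert (H2 := convex_on_chord m M f y c M Hf ltac:(lra) ltac:(lra) ltac:(lra) ltac:(lra)).
  assert (L2 : f c - f y <= S * (c - y)).
  { apply Rmult_le_reg_l with (M - c); [lra|].
    replace (f M) with (f c + S * (M - c)) in H2 by lra. lra. }
  assert (L1 : f y - f x <= S * (y - x)).
  { apply Rmult_le_reg_l with (c - y); [lra|]. nra. }
  lra. }
pose (E := fun z => exists x, m < x < c /\ z = f x - S * x).
assert (HS : - Rabs S <= S <= Rabs S) by (apply Rabs_le_between; lra).
assert (HB : bound E).
{ exists (Rabs (f m) + Rabs (f M) + Rabs S * (Rabs m + Rabs M)).
  intros z [x [Hx ->]].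
  assert (H := convex_on_chord m M f m x M Hf ltac:(lra) ltac:(lra) ltac:(lra) ltac:(lra)).
  assert (Hm := Rle_abs (f m)). assert (HM := Rle_abs (f M)).
  assert (Pm := Rabs_pos (f m)). assert (PM := Rabs_pos (f M)).
  assert (Hfx : f x <= Rabs (f m) + Rabs (f M)).
  { apply Rmult_le_reg_l with (M - m); [lra|]. nra. }
  assert (Hx' : Rabs x <= Rabs m + Rabs M).
  { assert (- Rabs m <= m <= Rabs m) by (apply Rabs_le_between; lra).
    assert (- Rabs M <= M <= Rabs M) by (apply Rabs_le_between; lra).
    apply Rabs_le_between. lra. }
  assert (Hp : - (S * x) <= Rabs S * Rabs x).
  { rewrite <- Rabs_mult, <- Rabs_Ropp. apply Rle_abs. }
  assert (Rabs S * Rabs x <= Rabs S * (Rabs m + Rabs M))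
    by (apply Rmult_le_compat_l; [apply Rabs_pos | exact Hx']).
  lra. }
assert (HE : exists z, E z).
{ exists (f ((m + c) / 2) - S * ((m + c) / 2)), ((m + c) / 2).
  split; [lra | reflexivity]. }
destruct (completeness E HB HE) as [H [Hub Hlub]].
exists (H + S * m). intros eps Heps.
assert (Hx0 : exists x0, m < x0 < c /\ H - eps / 2 < f x0 - S * x0).
{ apply Classical_Prop.NNPP. intros Hn.
  assert (H <= H - eps / 2); [|lra].
  apply Hlub. intros z [x [Hx ->]].
  apply Rnot_lt_le. intros Hlt. apply Hn. exists x. auto. }
destruct Hx0 as [x0 [Hx0 Hh]].
assert (HK : 0 < Rabs S + 1) by (assert (P := Rabs_pos S); lra).
exists (Rmin (x0 - m) (eps / 2 / (Rabs S + 1))).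
split.
{ apply Rmin_glb_lt; [lra|]. apply Rdiv_lt_0_compat; lra. }
intros x [Hx1 Hx2].
assert (Ha := Rmin_l (x0 - m) (eps / 2 / (Rabs S + 1))).
assert (Hb := Rmin_r (x0 - m) (eps / 2 / (Rabs S + 1))).
assert (Hm := Hmon x x0 ltac:(lra) ltac:(lra) ltac:(lra)).
assert (Hu : f x - S * x <= H) by (apply Hub; exists x; split; [lra|reflexivity]).
assert (Hs : (Rabs S + 1) * (x - m) < eps / 2).
{ replace (eps / 2) with ((Rabs S + 1) * (eps / 2 / (Rabs S + 1))) by (field; lra).
  apply Rmult_lt_compat_l; lra. }
apply Rabs_lt_between. split; nra.
Qed.

Lemma convex_on_left_limit m M f :
  m < M -> convex_on m M f ->
  exists L, forall eps, 0 < eps -> exists d, 0 < d /\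
    forall x, M - d < x < M -> Rabs (f x - L) < eps.
Proof.
intros HmM Hf.
assert (Hg : convex_on m M (fun t => f (-1 * t + (M + m)))).
{ apply convex_on_affine_comp with (1 := Hf). intros t Ht; lra. }
destruct (convex_on_right_limit m M _ HmM Hg) as [L HL].
exists L. intros eps Heps.
destruct (HL eps Heps) as [d [Hd H]].
exists d. split; [exact Hd|]. intros x Hx.
specialize (H (M + m - x) ltac:(lra)).
replace (-1 * (M + m - x) + (M + m)) with x in H by ring.
exact H.
Qed.

(** Possible jumps at the endpoints do not affect the integral, so [f] may be
    replaced by the continuous extension of its restriction to the open
    interval. *)
Lemma convex_on_ex_RInt m M f :
  m < M -> convex_on m M f -> ex_RInt f m M.
Proof.
intros HmM Hf.
destruct (convex_on_right_limit m M f HmM Hf) as [la Hla].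
destruct (convex_on_left_limit m M f HmM Hf) as [lb Hlb].
destruct (C0_extension_lt f la lb m M HmM) as [g [Hg [Hfg _]]].
- intros c Hc. exact (convex_on_continuous m M f c Hf Hc).
- apply filterlim_locally. intros eps.
  destruct (Hla eps (cond_pos eps)) as [d [Hd H]].
  exists (mkposreal d Hd). intros y Hy Hlt.
  change (Rabs (y - m) < d) in Hy. apply Rabs_lt_between in Hy.
  apply (H y). lra.
- apply filterlim_locally. intros eps.
  destruct (Hlb eps (cond_pos eps)) as [d [Hd H]].
  exists (mkposreal d Hd). intros y Hy Hlt.
  change (Rabs (y - M) < d) in Hy. apply Rabs_lt_between in Hy.
  apply (H y). lra.
- apply ex_RInt_ext with g.
  + rewrite Rmin_left, Rmax_right by lra. exact Hfg.
  + apply (ex_RInt_continuous (V := R_CompleteNormedModule)).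
    intros z _. apply Hg.
Qed.

Lemma convex_on_ex_RInt_sub m M f x y :
  m < M -> convex_on m M f -> m <= x <= M -> m <= y <= M -> ex_RInt f x y.
Proof.
intros HmM Hf.
assert (Hle : forall u v, m <= u -> u <= v -> v <= M -> ex_RInt f u v).
{ intros u v Hu Huv Hv.
  apply (ex_RInt_Chasles_2 (V := R_CompleteNormedModule)) with m; [lra|].
  apply (ex_RInt_Chasles_1 (V := R_CompleteNormedModule)) with M; [lra|].
  exact (convex_on_ex_RInt m M f HmM Hf). }
intros Hx Hy. destruct (Rle_dec x y).
- apply Hle; lra.
- apply ex_RInt_swap, Hle; lra.
Qed.

(** * The Hermite-Hadamard inequality *)

(** Averaging [g t] with [g (1 - t)] leaves the integral unchanged and turns
    both bounds into pointwise ones. *)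
Lemma hermite_hadamard g :
  convex_on 0 1 g -> g (1 / 2) <= RInt g 0 1 <= (g 0 + g 1) / 2.
Proof.
intros Hg.
assert (Ig := convex_on_ex_RInt 0 1 g Rlt_0_1 Hg).
assert (Hr : convex_on 0 1 (fun t => g (-1 * t + 1))).
{ apply convex_on_affine_comp with (1 := Hg). intros t Ht; lra. }
assert (Ir := convex_on_ex_RInt 0 1 _ Rlt_0_1 Hr).
assert (Er : RInt (fun t => g (-1 * t + 1)) 0 1 = RInt g 0 1).
{ assert (E := RInt_comp_lin g (-1) 1 0 1).
  replace (-1 * 0 + 1) with 1 in E by ring.
  replace (-1 * 1 + 1) with 0 in E by ring.
  specialize (E (ex_RInt_swap _ _ _ Ig)).
  rewrite RInt_scal in E by exact Ir.
  rewrite <- (opp_RInt_swap g 0 1) in E by exact Ig.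
  change (-1 * RInt (fun t => g (-1 * t + 1)) 0 1 = - RInt g 0 1) in E.
  lra. }
assert (Es := RInt_plus g _ 0 1 Ig Ir). rewrite Er in Es.
change (RInt (fun t => g t + g (-1 * t + 1)) 0 1 = RInt g 0 1 + RInt g 0 1) in Es.
assert (Is : ex_RInt (fun t => g t + g (-1 * t + 1)) 0 1)
  by exact (ex_RInt_plus g _ 0 1 Ig Ir).
assert (Ec : forall c : R, RInt (fun _ => c) 0 1 = c).
{ intros c. rewrite RInt_const. change ((1 - 0) * c = c). ring. }
split.
- assert (H : RInt (fun _ => 2 * g (1 / 2)) 0 1
              <= RInt (fun t => g t + g (-1 * t + 1)) 0 1).
  { apply RInt_le; [lra | apply ex_RInt_const | exact Is |].
    intros t Ht.
    assert (H := Hg t (-1 * t + 1) (1 / 2) ltac:(lra) ltac:(lra) ltac:(lra)).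
    replace ((1 - 1 / 2) * t + 1 / 2 * (-1 * t + 1)) with (1 / 2) in H by field.
    lra. }
  rewrite Ec in H. lra.
- assert (H : RInt (fun t => g t + g (-1 * t + 1)) 0 1
              <= RInt (fun _ => g 0 + g 1) 0 1).
  { apply RInt_le; [lra | exact Is | apply ex_RInt_const |].
    intros t Ht.
    assert (H := convex_on_reflection 0 1 g t Rlt_0_1 Hg ltac:(lra)).
    replace (1 + 0 - t) with (-1 * t + 1) in H by ring. exact H. }
  rewrite Ec in H. lra.
Qed.

(** Parametrizing the segment by [[0, 1]] treats both orientations and the
    degenerate case at once. *)
Lemma reflected_mean_segment m M f b x :
  m < M -> convex_on m M f -> m <= b <= M -> m <= x <= M ->
  reflected_mean m M f b x
  = RInt (fun t => f ((b - x) * t + (M + m - b))) 0 1.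
Proof.
intros HmM Hf Hb Hx. unfold reflected_mean.
destruct (Req_EM_T x b) as [->|Hne].
- rewrite (RInt_ext _ (fun _ => f (M + m - b))).
  + rewrite RInt_const. change (f (M + m - b) = (1 - 0) * f (M + m - b)). ring.
  + intros t _. apply f_equal. ring.
- assert (E := RInt_comp_lin f (b - x) (M + m - b) 0 1).
  replace ((b - x) * 0 + (M + m - b)) with (M + m - b) in E by ring.
  replace ((b - x) * 1 + (M + m - b)) with (M + m - x) in E by ring.
  rewrite <- E by (apply convex_on_ex_RInt_sub with m M; auto; lra).
  rewrite RInt_scal.
  + change (/ (b - x) * ((b - x) *
      RInt (fun t => f ((b - x) * t + (M + m - b))) 0 1)
      = RInt (fun t => f ((b - x) * t + (M + m - b))) 0 1).
    field. lra.
  + apply convex_on_ex_RInt; [lra|].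
    apply convex_on_affine_comp with (1 := Hf). intros t Ht; nra.
Qed.

Lemma average_between m M f b x :
  m < M -> convex_on m M f -> m <= b <= M -> m <= x <= M ->
  f (M + m - (b + x) / 2) <= reflected_mean m M f b x
    <= (f (M + m - b) + f (M + m - x)) / 2.
Proof.
intros HmM Hf Hb Hx.
rewrite reflected_mean_segment by assumption.
assert (H := hermite_hadamard (fun t => f ((b - x) * t + (M + m - b)))).
cbv beta in H.
replace ((b - x) * (1 / 2) + (M + m - b)) with (M + m - (b + x) / 2) in H by field.
replace ((b - x) * 0 + (M + m - b)) with (M + m - b) in H by ring.
replace ((b - x) * 1 + (M + m - b)) with (M + m - x) in H by ring.
apply H. apply convex_on_affine_comp with (1 := Hf). intros t Ht; nra.
Qed.

(** * Weighted sums and Jensen's inequality *)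

Lemma sum_n_m_weighted_le (w u v : nat -> R) n :
  (forall i, (1 <= i <= n)%nat -> 0 <= w i) ->
  (forall i, (1 <= i <= n)%nat -> u i <= v i) ->
  sum_n_m (fun i => w i * u i) 1 n <= sum_n_m (fun i => w i * v i) 1 n.
Proof.
induction n as [|n IH]; intros Hw Huv.
- rewrite !sum_n_m_zero by lia. apply Rle_refl.
- rewrite !sum_n_Sm by lia. apply Rplus_le_compat.
  + apply IH; intros i Hi; [apply Hw | apply Huv]; lia.
  + apply Rmult_le_compat_l; [apply Hw | apply Huv]; lia.
Qed.

Lemma sum_n_m_weighted_affine (w u : nat -> R) (b c : R) n :
  sum_n_m (fun i => w i * (c + b * u i)) 1 n
  = c * sum_n_m w 1 n + b * sum_n_m (fun i => w i * u i) 1 n.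
Proof.
induction n as [|n IH].
- rewrite !sum_n_m_zero by lia. change (0 = c * 0 + b * 0). ring.
- rewrite !sum_n_Sm by lia. rewrite IH. unfold plus; simpl. ring.
Qed.

(** Leaving the total weight arbitrary and the mean existential makes the
    induction go through without renormalizing the weights, and covers initial
    segments of total weight zero. *)
Lemma jensen_unnormalized m M f (w u : nat -> R) n :
  m <= M -> convex_on m M f ->
  (forall i, (1 <= i <= n)%nat -> 0 <= w i) ->
  (forall i, (1 <= i <= n)%nat -> m <= u i <= M) ->
  0 <= sum_n_m w 1 n /\
  exists c, m <= c <= M /\
    sum_n_m (fun i => w i * u i) 1 n = sum_n_m w 1 n * c /\
    sum_n_m w 1 n * f c <= sum_n_m (fun i => w i * f (u i)) 1 n.
Proof.
intros HmM Hf. induction n as [|n IH]; intros Hw Hu.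
- rewrite !sum_n_m_zero by lia. unfold zero; simpl.
  split; [lra|]. exists m. lra.
- destruct IH as [HW [c [Hc [E H]]]].
  { intros i Hi; apply Hw; lia. }
  { intros i Hi; apply Hu; lia. }
  rewrite !sum_n_Sm by lia. unfold plus; simpl.
  assert (Hw' := Hw (S n) ltac:(lia)). assert (Hu' := Hu (S n) ltac:(lia)).
  rewrite E.
  set (W := sum_n_m w 1 n) in *. set (v := w (S n)) in *.
  set (x := u (S n)) in *. clearbody W v x.
  split; [lra|].
  destruct (Req_EM_T (W + v) 0) as [H0|H0].
  + exists c. assert (W = 0) by lra. assert (v = 0) by lra. subst.
    repeat split; lra.
  + set (t := v / (W + v)).
    assert (Et : (W + v) * t = v) by (unfold t; field; lra).
    assert (Ht : 0 <= t <= 1) by (split; nra).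
    exists ((1 - t) * c + t * x).
    split; [split; nra|].
    split.
    * replace ((W + v) * ((1 - t) * c + t * x))
        with ((W + v - (W + v) * t) * c + (W + v) * t * x) by ring.
      rewrite Et. ring.
    * apply Rle_trans with ((W + v) * ((1 - t) * f c + t * f x)).
      { apply Rmult_le_compat_l; [lra|]. apply Hf; auto. }
      replace ((W + v) * ((1 - t) * f c + t * f x))
        with ((W + v - (W + v) * t) * f c + (W + v) * t * f x) by ring.
      rewrite Et. lra.
Qed.

Lemma jensen m M f (w u : nat -> R) n :
  m <= M -> convex_on m M f ->
  (forall i, (1 <= i <= n)%nat -> 0 <= w i) ->
  (forall i, (1 <= i <= n)%nat -> m <= u i <= M) ->
  sum_n_m w 1 n = 1 ->
  m <= sum_n_m (fun i => w i * u i) 1 n <= M /\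
  f (sum_n_m (fun i => w i * u i) 1 n)
    <= sum_n_m (fun i => w i * f (u i)) 1 n.
Proof.
intros HmM Hf Hw Hu H1.
destruct (jensen_unnormalized m M f w u n HmM Hf Hw Hu) as [_ [c [Hc [E H]]]].
rewrite H1 in E, H. rewrite E, Rmult_1_l.
split; [exact Hc | lra].
Qed.

(** * The refined Jensen-Mercer inequality *)

Theorem corollary2p1 (m M : R) (hmM : m < M)
    (f : R -> R) (hf : convex_on m M f)
    (n : nat) (hn : (1 <= n)%nat) (a w : nat -> R)
    (ha : forall i : nat, (1 <= i <= n)%nat -> m <= a i <= M)
    (hw : forall i : nat, (1 <= i <= n)%nat -> 0 <= w i <= 1)
    (hw1 : sum_n_m w 1 n = 1) :
  let abar := sum_n_m (fun i => w i * a i) 1 n in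
  f (M + m - abar)
    <= sum_n_m (fun i => w i * reflected_mean m M f abar (a i)) 1 n /\
  sum_n_m (fun i => w i * reflected_mean m M f abar (a i)) 1 n
    <= f M + f m - sum_n_m (fun i => w i * f (a i)) 1 n.
Proof.
intros abar.
assert (Hw0 : forall i, (1 <= i <= n)%nat -> 0 <= w i)
  by (intros i Hi; apply hw; exact Hi).
assert (Hb : m <= abar <= M)
  by exact (proj1 (jensen m M f w a n ltac:(lra) hf Hw0 ha hw1)).
split.
- (* The points are the midpoints of the reflections of [abar] and [a i],
     written affinely in [a i]. *)
  assert (J := jensen m M f w (fun i => (M + m - abar / 2) + (-1/2) * a i) n
                 ltac:(lra) hf Hw0).
  cbv beta in J; rewrite (sum_n_m_weighted_affine w a), hw1 in J. fold abar in J.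
  replace ((M + m - abar / 2) * 1 + -1 / 2 * abar) with (M + m - abar) in J by field.
  apply Rle_trans with (1 := proj2 (J ltac:(intros i Hi; specialize (ha i Hi); lra) eq_refl)).
  apply sum_n_m_weighted_le; [exact Hw0|]. intros i Hi.
  replace (M + m - abar / 2 + -1 / 2 * a i) with (M + m - (abar + a i) / 2) by field.
  apply average_between; auto.
- assert (J := jensen m M f w (fun i => (M + m) + (-1) * a i) n ltac:(lra) hf Hw0).
  cbv beta in J; rewrite (sum_n_m_weighted_affine w a), hw1 in J. fold abar in J.
  replace ((M + m) * 1 + -1 * abar) with (M + m - abar) in J by ring.
  assert (J' := proj2 (J ltac:(intros i Hi; specialize (ha i Hi); lra) eq_refl)).
  clear J.
  assert (Hq : forall i, (1 <= i <= n)%nat ->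
            f (M + m + -1 * a i) <= (f M + f m) + -1 * f (a i)).
  { intros i Hi. assert (H := convex_on_reflection m M f (a i) hmM hf (ha i Hi)).
    replace (M + m + -1 * a i) with (M + m - a i) by ring. lra. }
  assert (Hp : f (M + m - abar)
            <= f M + f m - sum_n_m (fun i => w i * f (a i)) 1 n).
  { apply Rle_trans with (1 := J').
    apply Rle_trans with (1 := sum_n_m_weighted_le w _ _ n Hw0 Hq).
    rewrite (sum_n_m_weighted_affine w (fun i => f (a i))), hw1. lra. }
  apply Rle_trans with (sum_n_m (fun i =>
    w i * ((f (M + m - abar) + (f M + f m)) / 2 + (-1/2) * f (a i))) 1 n).
  + apply sum_n_m_weighted_le; [exact Hw0|]. intros i Hi.
    apply Rle_trans with (1 := proj2 (average_between m M f abar (a i) hmM hf Hb (ha i Hi))).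
    assert (H := Hq i Hi).
    replace (M + m + -1 * a i) with (M + m - a i) in H by ring. lra.
  + rewrite (sum_n_m_weighted_affine w (fun i => f (a i))), hw1. lra.
Qed.
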